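(* Let $(\Xi,d)$ be a compact metric space and let $\mu$ be a discrete probability measure on $\Xi$ with finite support. Assume that there exists a set of $K$ points $\{\theta_1^*,\dots,\theta_K^*\}\subsetneq \mathrm{supp}(\mu)$ (proper inclusion) satisfying: (1) there exists $1\le i\le K$ such that for all $\theta\in\mathrm{supp}(\mu)\setminus\{\theta_1^*,\dots,\theta_K^*\}$, $$\frac{m_N(\theta)}{m_N(\theta_i^* )}\underset{N\to\infty}{\longrightarrow}0;$$ (2) for each $1\le i,j\le K$ with $i\ne j$, $$\frac{m_N(\theta_j^* )}{m_N(\theta_i^* )}\underset{N\to\infty}{\longrightarrow}d_{i,j}>0.$$ Then there is emerging dominance at $\{\theta_1^*,\dots,\theta_K^*\}$ with weights $$w_i=\frac{1}{1+\sum_{j=1,\,j\ne i}^K\frac{\mu(\theta_j^* )}{\mu(\theta_i^* )}d_{i,j}},\qquad i=1,\dots,K.$$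
   Context: Setting (sequence of Self-Switching Markov Chains). $\Xi$ is a compact metric space and $\mu$ a Borel probability measure on $\Xi$. $(\mathcal X_N)_{N\ge1}$ is an increasing sequence of finite sets, $x_0\in\mathcal X_1$, $T_N\subset\mathcal X_N$ with $x_0\notin T_N$, and for each $N\ge1$, $(Q_N^{(\theta)})_{\theta\in\Xi}$ is a family of irreducible stochastic matrices on $\mathcal X_N$. For $\theta\in\Xi$, $m_N(\theta)$ denotes the expected first time that the Markov chain on $\mathcal X_N$ started at $x_0$ with transition matrix $Q_N^{(\theta)}$ hits $T_N$. Standing assumption: for each $N$, the function $m_N:\Xi\to\mathbb R$ is continuous. For Borel $A\subseteq\Xi$ set $\widehat P_N(A):=\dfrac{\int_A m_N\,d\mu}{\int_\Xi m_N\,d\mu}$, a probability measure on $\Xi$. Emerging dominance: given $\{\theta_1^*,\dots,\theta_K^*\}\subsetneq\mathrm{supp}(\mu)$, there is emerging dominance at $\{\theta_1^*,\dots,\theta_K^*\}$ with positive weights $\{w_1,\dots,w_K\}$ if $\sum_{i=1}^K w_i=1$ and $\widehat P_N$ converges weakly, as $N\to\infty$, to $\sum_{i=1}^K w_i\delta_{\theta_i^*}$. *)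

(* Defs.v *)
From HB Require Import structures.
From mathcomp Require Import all_boot all_order all_algebra finmap.
From mathcomp Require Import all_classical all_reals all_analysis.

Set Implicit Arguments.
Unset Strict Implicit.
Unset Printing Implicit Defensive.

Import Order.TTheory GRing.Theory Num.Theory.
Import numFieldNormedType.Exports.

Local Open Scope classical_set_scope.
Local Open Scope ring_scope.

(* [measurableType] requires a distinguished point, which [metricType] does not
   provide.  A space carrying a probability measure is nonempty, so asking for a
   point is no restriction. *)
#[short(type="pmetricType")]
HB.structure Definition PointedMetric (R : numDomainType) :=
  { M of Pointed M & Metric R M }.

Notation borelType Xi := (g_sigma_algebraType (@open Xi)).

Section finite_markov_chains.
Context {R : realType} {V : choiceType}.

Definition stochastic (S : {fset V}) (Q : S -> S -> R) : Prop :=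
  (forall x y, 0 <= Q x y) /\ (forall x, \sum_y Q x y = 1).

Fixpoint nstep (S : {fset V}) (Q : S -> S -> R) (n : nat) (x y : S) : R :=
  if n is n'.+1 then \sum_z Q x z * nstep Q n' z y else (x == y)%:R.

Definition irreducible_matrix (S : {fset V}) (Q : S -> S -> R) : Prop :=
  forall x y, exists n, 0 < nstep Q n x y.

(* The Markov property is stated multiplicatively,
     P(Y_0 = a_0, ..., Y_{n+1} = a_{n+1})
       = P(Y_0 = a_0, ..., Y_n = a_n) Q(a_n, a_{n+1}),
   to avoid conditioning on null events. *)
Definition markov_chain d (Omega : measurableType d) (P : probability Omega R)
    (S : {fset V}) (x0 : V) (Q : S -> S -> R) (Y : nat -> Omega -> S) : Prop :=
  [/\ forall n x, measurable (Y n @^-1` [set x]),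
      P [set w | val (Y 0%N w) = x0] = 1%E &
      forall (n : nat) (a : nat -> S),
        P [set w | forall k, (k <= n.+1)%N -> Y k w = a k] =
        (P [set w | forall k, (k <= n)%N -> Y k w = a k] *
           (Q (a n) (a n.+1))%:E)%E].

(* The infimum of the empty set is +oo: the value when T is never hit. *)
Definition hitting_time (Omega : Type) (S : {fset V}) (Y : nat -> Omega -> S)
    (T : {fset V}) (w : Omega) : \bar R :=
  ereal_inf [set (n%:R : R)%:E | n in [set n | val (Y n w) \in T]].

(* The expectation of the hitting time depends only on the law of the chain,
   hence not on the realization chosen; requiring it to be the real number m
   includes its finiteness. *)
Definition expected_hitting_time (S : {fset V}) (x0 : V) (T : {fset V})
    (Q : S -> S -> R) (m : R) : Prop :=
  exists (d : measure_display) (Omega : measurableType d)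
         (P : probability Omega R) (Y : nat -> Omega -> S),
    markov_chain P x0 Q Y /\ (\int[P]_w hitting_time Y T w = m%:E)%E.

End finite_markov_chains.

Section emerging_dominance.
Context {R : realType} {Xi : pmetricType R}.
Implicit Types mu : probability (borelType Xi) R.

Definition supp mu : set Xi :=
  [set x | forall U : set Xi, open U -> U x -> (0 < mu U)%E].

Definition discrete_probability mu : Prop :=
  exists D : set (borelType Xi), [/\ countable D, measurable D & mu D = 1%E].

Definition hatP mu (m : Xi -> R) (A : set (borelType Xi)) : \bar R :=
  ((\int[mu]_(x in A) (m x)%:E) / (\int[mu]_x (m x)%:E))%E.

Definition weakly_converges (P : nat -> probability (borelType Xi) R)
    (Q : probability (borelType Xi) R) : Prop :=
  forall f : Xi -> R, continuous f -> bounded_fun f ->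
    (\int[P N]_x (f x)%:E)%E @[N --> \oo] --> (\int[Q]_x (f x)%:E)%E.

(* Probability measures P N and Q are introduced only to package the set
   functions hatP and \sum_i w_i \delta_{theta_i}, which determine them; the
   time index N runs over N >= 1. *)
Definition emerging_dominance mu (m : nat -> Xi -> R) (K : nat)
    (theta : 'I_K -> Xi) (w : 'I_K -> R) : Prop :=
  [/\ range theta `<` supp mu,
      forall i, 0 < w i,
      \sum_i w i = 1 &
      exists (P : nat -> probability (borelType Xi) R)
             (Q : probability (borelType Xi) R),
        [/\ forall N A, (0 < N)%N -> measurable A -> P N A = hatP mu (m N) A,
            forall A, measurable A ->
              Q A = (\sum_i (w i)%:E * \d_(theta i : borelType Xi) A)%E &
            weakly_converges P Q]].

End emerging_dominance.

(* Main.v *)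
Require Import Defs.
From mathcomp Require Import all_boot all_order all_algebra finmap.
From mathcomp Require Import all_classical all_reals all_analysis.
From mathcomp Require Import measurable_realfun.
Import Order.TTheory GRing.Theory Num.Theory.
Import numFieldNormedType.Exports.

Local Open Scope classical_set_scope.
Local Open Scope ring_scope.

(** The measure [mu] is carried by its support, which is finite: it is carried
    by a countable set, and a point outside the support is a null set, having
    a null open neighbourhood. Write the support as
    [a_0, ..., a_(n-1)] and put [p_i = mu {a_i} > 0]. Integrals against [mu]
    are then finite sums, so that [hatP] at time [N] is the mixture of the
    Dirac masses at the [a_i] with weights
      [v_N(i) = p_i m_N(a_i) / \sum_j p_j m_N(a_j)].
    These weights make sense because the chain starts outside the target:
    every hitting time is at least 1 almost surely, hence [m_N >= 1]
    ([expected_hitting_time_ge1]).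

    Everything reduces to the limits of finitely many real sequences
    ([normalized_weight_cvg]). If [a_i = theta_k], divide numerator and
    denominator of [v_N(i)] by [p_i m_N(theta_k)]: each ratio
    [m_N(a_j) / m_N(theta_k)] has a limit, namely [d k l] when
    [a_j = theta_l] with [l <> k], and 0 when [a_j] is not one of the [theta].
    The latter is assumed for one index [k0] only, and is transferred to [k]
    on multiplying by [m_N(theta_k0) / m_N(theta_k)], which converges. So
    [v_N(i)] tends to [w_k]. If [a_i] is not one of the [theta], then [v_N(i)]
    is a null sequence times the weight of some [theta_k], and tends to 0.
    The limits sum to 1 because the weights do for every [N], and the integral
    of a test function, a finite sum weighted by [v_N], converges to the sum
    weighted by [w]. *)

(** * Limits of normalized weights *)

(** The image under [s] of the measure on ['I_K] with point masses [g]. It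
    turns limits indexed by the selected points into limits indexed by all
    the atoms. *)
Definition push_weights {R : realType} {n K : nat} (s : 'I_K -> 'I_n)
  (g : 'I_K -> R) (i : 'I_n) : R := \sum_k g k * (s k == i)%:R.

Lemma push_weights_im (R : realType) (n K : nat) (s : 'I_K -> 'I_n)
    (g : 'I_K -> R) (k : 'I_K) :
  injective s -> push_weights s g (s k) = g k.
Proof.
move=> s_inj; rewrite /push_weights (bigD1 k)//= eqxx mulr1 big1 ?addr0// => j jk.
by rewrite (inj_eq s_inj) (negbTE jk) mulr0.
Qed.

Lemma push_weights_out (R : realType) (n K : nat) (s : 'I_K -> 'I_n)
    (g : 'I_K -> R) (i : 'I_n) :
  (forall k, s k != i) -> push_weights s g i = 0.
Proof.
by move=> si; rewrite /push_weights big1// => k _; rewrite (negbTE (si k)) mulr0.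
Qed.

Lemma sum_push_weights (R : realType) (n K : nat) (s : 'I_K -> 'I_n)
    (g : 'I_K -> R) (f : 'I_n -> R) :
  \sum_i push_weights s g i * f i = \sum_k g k * f (s k).
Proof.
under eq_bigr do rewrite /push_weights mulr_suml.
rewrite exchange_big /=; apply: eq_bigr => k _.
rewrite (bigD1 (s k))//= eqxx mulr1 big1 ?addr0// => i.
by rewrite eq_sym => /negbTE ->; rewrite mulr0 mul0r.
Qed.

Lemma cvg_sum_ord (R : realType) (n : nat) (u : nat -> 'I_n -> R)
    (l : 'I_n -> R) :
  (forall i, u N i @[N --> \oo] --> l i) ->
  \sum_i u N i @[N --> \oo] --> \sum_i l i.
Proof. by move=> ul; apply: cvg_big => //; exact: add_continuous. Qed.

Section weights.
Context {R : realType} {n K : nat}.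
Variables (p : 'I_n -> R) (u : nat -> 'I_n -> R) (s : 'I_K -> 'I_n).
Variable d : 'I_K -> 'I_K -> R.
Hypothesis p_gt0 : forall i, 0 < p i.
Hypothesis u_gt0 : forall N i, 0 < u N i.
Hypothesis s_inj : injective s.
Hypothesis out_cvg0 : exists k0, forall i, (forall k, s k != i) ->
  u N i / u N (s k0) @[N --> \oo] --> (0 : R).
Hypothesis ratio_cvg : forall k j, k != j ->
  u N (s j) / u N (s k) @[N --> \oo] --> d k j /\ 0 < d k j.

(** If [c_j] is the limit of [u (s j) / u (s k)], so that [c_k = 1], this is
    [p_(s k) c_k / \sum_j p_(s j) c_j]. *)
Definition limit_weight (k : 'I_K) : R :=
  1 / (1 + \sum_(j < K | j != k) p (s j) / p (s k) * d k j).

Lemma limit_weight_gt0 k : 0 < limit_weight k.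
Proof.
rewrite divr_gt0// ltr_wpDr// sumr_ge0// => j jk.
by rewrite mulr_ge0 ?divr_ge0 ?(ltW (p_gt0 _))// ltW// (ratio_cvg _ _ _).2// eq_sym.
Qed.

(** The index [k0] of the hypothesis may be replaced by any [k], since
    [u (s k0) / u (s k)] converges. *)
Lemma out_ratio_cvg0 k i : (forall k, s k != i) ->
  u N i / u N (s k) @[N --> \oo] --> (0 : R).
Proof.
have [k0 Hk0] := out_cvg0 => si.
have [->|kk0] := eqVneq k k0; first exact: Hk0.
rewrite -(mul0r (d k k0)).
rewrite [X in X @ _ --> _](_ : _ =
  (fun N => (u N i / u N (s k0)) * (u N (s k0) / u N (s k)))); last first.
  by apply/funext => N; rewrite mulrA divfK// gt_eqF.
by apply: cvgM; [exact: Hk0 | exact: (ratio_cvg _ _ kk0).1].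
Qed.

(** The inverse of the left-hand side is a finite sum of convergent ratios,
    with limit at least 1. *)
Lemma im_weight_cvg k :
  p (s k) * u N (s k) / (\sum_i p i * u N i) @[N --> \oo] --> limit_weight k.
Proof.
(* The limit of p_(s j) u (s j) / (p_(s k) u (s k)). *)
pose g j := if j == k then 1 else p (s j) / p (s k) * d k j.
have gE : \sum_i push_weights s g i =
    1 + \sum_(j < K | j != k) p (s j) / p (s k) * d k j.
  under eq_bigr do rewrite -[push_weights _ _ _]mulr1.
  rewrite (sum_push_weights _ _ _ _ _ (fun=> 1)) (bigD1 k)//= /g eqxx mulr1.
  by congr (_ + _); apply: eq_bigr => j /negbTE ->; rewrite mulr1.
have g_gt0 : 0 < \sum_i push_weights s g i.
  by rewrite gE -invr_gt0 -div1r; exact: limit_weight_gt0.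
rewrite /limit_weight -gE div1r.
rewrite [X in X @ _ --> _](_ : _ =
  (fun N => (\sum_i p i / p (s k) * (u N i / u N (s k)))^-1)); last first.
  apply/funext => N.
  rewrite [X in _ = X^-1](_ : _ = (\sum_i p i * u N i) / (p (s k) * u N (s k))).
    by rewrite invf_div.
  by rewrite mulr_suml; apply: eq_bigr => i _; rewrite mulf_div.
apply: cvgV; first exact: lt0r_neq0.
apply: cvg_sum_ord => i.
have [[j sj]|si] := pselect (exists j, s j = i); last first.
  have si' j : s j != i by apply/eqP => sj; apply: si; exists j.
  rewrite push_weights_out// -(mulr0 (p i / p (s k))).
  by apply: cvgMl_tmp; exact: out_ratio_cvg0.
rewrite -sj push_weights_im// /g; case: eqVneq => [->|jk].
  rewrite [X in X @ _ --> _](_ : _ = (fun=> 1)); first exact: cvg_cst.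
  by apply/funext => N; rewrite !divff ?mulr1// lt0r_neq0.
by apply: cvgMl_tmp; apply: (ratio_cvg _ _ _).1; rewrite eq_sym.
Qed.

(** Outside the image of [s], the weight is a null sequence times the weight
    of any point of the image, which converges by [im_weight_cvg]. *)
Lemma normalized_weight_cvg i :
  p i * u N i / (\sum_j p j * u N j) @[N --> \oo] -->
    push_weights s limit_weight i.
Proof.
have [[j <-]|si] := pselect (exists j, s j = i).
  by rewrite push_weights_im//; exact: im_weight_cvg.
have si' j : s j != i by apply/eqP => sj; apply: si; exists j.
have [k _] := out_cvg0.
have -> : push_weights s limit_weight i = p i / p (s k) * 0 * limit_weight k.
  by rewrite push_weights_out// mulr0 mul0r.
rewrite [X in X @ _ --> _](_ : _ =
  (fun N => (p i / p (s k) * (u N i / u N (s k))) *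
     (p (s k) * u N (s k) / (\sum_j p j * u N j)))).
  by apply: cvgM; [apply: cvgMl_tmp; exact: out_ratio_cvg0|exact: im_weight_cvg].
apply/funext => N; rewrite [X in _ = X * _]mulf_div mulrA divfK//.
by rewrite mulf_neq0// lt0r_neq0.
Qed.

(** The normalized weights sum to 1 for every [N], and a finite sum commutes
    with limits. This avoids proving the cocycle relation
    [d i j * d j k = d i k], on which a direct computation would rest. *)
Lemma sum_limit_weight : \sum_k limit_weight k = 1.
Proof.
have [k0 _] := out_cvg0.
have sum_gt0 N : 0 < \sum_j p j * u N j.
  rewrite (bigD1 (s k0))//= ltr_pwDl ?mulr_gt0//.
  by rewrite sumr_ge0// => i _; rewrite mulr_ge0 ?ltW.
have := cvg_sum_ord _ _ _ _ normalized_weight_cvg.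
rewrite [X in X @ _ --> _](_ : _ = (fun=> 1)); last first.
  by apply/funext => N; rewrite -mulr_suml divff// lt0r_neq0.
have -> : \sum_i push_weights s limit_weight i = \sum_k limit_weight k.
  under eq_bigr do rewrite -[push_weights _ _ _]mulr1.
  rewrite (sum_push_weights _ _ _ _ _ (fun=> 1)).
  by under eq_bigr do rewrite mulr1.
move=> H; symmetry; apply: (@cvg_unique R^o _ _ _ _ _ _ H).
  exact: Rhausdorff.
exact: cvg_cst.
Qed.
End weights.

(** * Measures carried by finitely many points *)

Lemma measurable_range_ord d (T : measurableType d) (n : nat) (a : 'I_n -> T) :
  (forall i, measurable [set a i]) -> measurable (range a).
Proof.
move=> ma; rewrite (_ : range a = \bigcup_(i in setT) [set a i]).
  by apply: fin_bigcup_measurable => // i _; exact: ma.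
by apply/seteqP; split => x [i _ xi]; exists i.
Qed.

(** On the range of [a], hence almost everywhere, the restriction of [f] to
    [D] is a linear combination of the indicators of the points [a i]:
    injectivity makes exactly one of them nonzero at each point. *)
Lemma integral_finite_support d (T : measurableType d) (R : realType)
    (nu : probability T R) (n : nat) (a : 'I_n -> T) (f : T -> R) (D : set T) :
  injective a -> (forall i, measurable [set a i]) ->
  nu (~` range a) = 0%E -> measurable D -> measurable_fun setT f ->
  (\int[nu]_(x in D) (f x)%:E =
   (\sum_i fine (nu [set a i]) * (f (a i) * \1_D (a i)))%:E)%E.
Proof.
move=> a_inj ma nu0 mD mf.
have mran := measurable_range_ord _ _ _ _ ma.
pose c i := f (a i) * \1_D (a i).
have intc i : nu.-integrable setT (fun x => (c i)%:E * (\1_[set a i] x)%:E)%E.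
  by apply: integrableZl => //; exact: integrable_indic.
rewrite integral_mkcond.
rewrite (@ae_eq_integral _ _ _ _ _
    (fun x => \sum_i (c i)%:E * (\1_[set a i] x)%:E)%E) //; last 3 first.
- rewrite (_ : _ \_ D = EFin \o (f \_ D)); last first.
    by apply/funext => x; rewrite /patch/=; case: ifP.
  apply/measurable_EFinP/(measurable_restrictT _ _).1 => //.
  exact: measurable_funTS.
- by apply: emeasurable_sum => i; apply: measurable_int (intc i).
- exists (~` range a); split => //; first exact: measurableC.
  move=> x /= Hx [i _ aix]; apply: Hx => _.
  rewrite (bigD1 i)//= big1 => [|j ji]; last first.
    rewrite indicE memNset ?mule0// => /= xj; move: ji.
    by rewrite -(inj_eq a_inj) -xj aix eqxx.
  rewrite -aix indicE mem_set// mule1 adde0 /c /patch indicE.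
  by case: ifP => _; rewrite ?mulr1 ?mulr0.
rewrite integral_sum// -sumEFin; apply: eq_bigr => i _.
rewrite integralZl//; last exact: integrable_indic.
rewrite integral_indic// setIT [RHS]EFinM fineK; last exact: fin_num_measure.
by rewrite muleC.
Qed.

Lemma exists_mixture d (T : measurableType d) (R : realType) (n : nat)
    (a : 'I_n -> T) (w : 'I_n -> R) :
  (forall i, 0 <= w i) -> \sum_i w i = 1 ->
  exists P : probability T R,
    forall A, P A = (\sum_i (w i)%:E * \d_(a i) A)%E.
Proof.
move=> w0 w1.
pose m_ (k : nat) : {measure set T -> \bar R} :=
  if insub k is Some i then mscale (NngNum (w0 i)) (\d_(a i)) else mzero.
have mE A : msum m_ n A = (\sum_i (w i)%:E * \d_(a i) A)%E.
  by apply: eq_bigr => i _; rewrite /m_ valK.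
have m1 : msum m_ n setT = 1%E.
  rewrite mE; under eq_bigr do rewrite diracT mule1.
  by rewrite sumEFin w1.
(* Normalizing leaves this measure of mass 1 unchanged and makes it a
   probability; the Dirac mass is a default value for degenerate measures. *)
exists (mnormalize (msum m_ n) (\d_point)) => A.
by rewrite /= /mnormalize/= m1 onee_eq0/= invr1 mule1 mE.
Qed.

Lemma mixture_set1 d (T : measurableType d) (R : realType) (n : nat)
    (a : 'I_n -> T) (w : 'I_n -> R) (i : 'I_n) : injective a ->
  (\sum_j (w j)%:E * \d_(a j) [set a i])%E = (w i)%:E :> \bar R.
Proof.
move=> a_inj; rewrite (bigD1 i)//= big1 => [|j ji]; rewrite diracE.
  by rewrite mem_set// mule1 adde0.
by rewrite memNset ?mule0// => /a_inj /eqP; apply/negP.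
Qed.

Lemma integral_mixture d (T : measurableType d) (R : realType) (n : nat)
    (a : 'I_n -> T) (w : 'I_n -> R) (P : probability T R) (f : T -> R) :
  injective a -> (forall i, measurable [set a i]) ->
  (forall A, measurable A -> P A = (\sum_i (w i)%:E * \d_(a i) A)%E) ->
  measurable_fun setT f ->
  (\int[P]_x (f x)%:E = (\sum_i w i * f (a i))%:E)%E.
Proof.
move=> a_inj ma PE mf.
rewrite (integral_finite_support _ _ _ _ _ _ _ setT a_inj)//; last first.
  rewrite PE; last exact/measurableC/measurable_range_ord.
  apply: big1 => i _; rewrite diracE memNset ?mule0//= => /(_ _); apply.
  by exists i.
congr (_%:E); apply: eq_bigr => i _.
by rewrite PE// mixture_set1// indicT mulr1.
Qed.

(** * Expected hitting times are at least 1 *)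

Lemma hitting_time_ge0 (R : realType) (V : choiceType) (Omega : Type)
    (S : {fset V}) (Y : nat -> Omega -> S) (T : {fset V}) (w : Omega) :
  (0 <= hitting_time Y T w :> \bar R)%E.
Proof. by apply: le_ereal_inf_tmp => _ [n _ <-]; rewrite lee_fin. Qed.

Section expected_hitting_time.
Import HBNNSimple.

(** The hitting time dominates the indicator of the event that the chain
    starts at [x0], which has probability 1. This bounds the integral below
    directly, as the integral of a nonnegative function is the supremum over
    the simple functions below it. *)
Lemma expected_hitting_time_ge1 (R : realType) (V : choiceType) (S : {fset V})
    (x0 : V) (T : {fset V}) (Q : S -> S -> R) (m : R) :
  x0 \notin T -> expected_hitting_time x0 T Q m -> 1 <= m.
Proof.
move=> x0T [d [W [P [Y [[mY P1 _] Em]]]]].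
pose E := [set w | val (Y 0%N w) = x0].
(* Measurability is given for the preimages of points of S only, so a state
   of S with value x0 is read off from a point of E. *)
have mE : measurable E.
  have [[w Ew]|E0] := pselect (exists w, E w); last first.
    by rewrite (_ : E = set0)// -subset0 => w Ew; apply: E0; exists w.
  rewrite (_ : E = Y 0%N @^-1` [set Y 0%N w])//.
  apply/seteqP; split => v; rewrite /E/= => Ev; last by rewrite Ev.
  by apply: val_inj; rewrite /= Ev; exact/esym.
rewrite -lee_fin -Em -P1 -(sintegral_indic P) ge0_integralTE; last first.
  by move=> w; exact: hitting_time_ge0.
apply: ereal_sup_ubound => /=.
exists (mindic R mE) => // w; rewrite /= mindicE.
have [Ew|_] := boolP (w \in E); last exact: hitting_time_ge0.
apply: le_ereal_inf_tmp => _ [n /= nT <-].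
case: n nT => [|n] nT; last by rewrite lee_fin ler1n.
by move: nT; rewrite (set_mem Ew) (negbTE x0T).
Qed.

End expected_hitting_time.

(** * Borel probability measures with finite support *)

Lemma negligible_countable d (T : measurableType d) (R : realType)
    (mu : {measure set T -> \bar R}) (A : set T) :
  countable A -> (forall x, A x -> mu.-negligible [set x]) -> mu.-negligible A.
Proof.
move=> /countable_injP[f finj] A0.
apply: (@negligibleS _ _ _ _ (\bigcup_k (A `&` f @^-1` [set k]))).
  by move=> x Ax; exists (f x).
apply: negligible_bigcup => k.
have [[x [Ax fx]]|Ak] := pselect (exists x, A x /\ f x = k); last first.
  apply: (@negligibleS _ _ _ _ set0); last exact: negligible_set0.
  by move=> x [Ax fx]; apply: Ak; exists x.
apply: (negligibleS _ (A0 x Ax)) => y [Ay /= fy].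
by apply: finj; rewrite ?inE// fy fx.
Qed.

Section borel_metric.
Context {R : realType} {Xi : pmetricType R}.

Lemma borel_open (U : set Xi) : open U -> measurable (U : set (borelType Xi)).
Proof. by move=> oU; exact: sub_sigma_algebra. Qed.

Lemma closed_finite_metric (A : set Xi) : finite_set A -> closed A.
Proof.
exact: (accessible_finite_set_closed.1 (hausdorff_accessible (@metric_hausdorff R Xi))).
Qed.

Lemma borel_finite (A : set Xi) :
  finite_set A -> measurable (A : set (borelType Xi)).
Proof.
move=> /closed_finite_metric cA; rewrite -[A]setCK.
by apply: measurableC; apply: borel_open; rewrite openC.
Qed.

Lemma borel_continuous (f : Xi -> R) :
  continuous f -> measurable_fun setT (f : borelType Xi -> R).
Proof.
move=> cf; apply: (measurability _ (RGenOpens.measurableE R)).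
move=> _ [_ [x [y ->]] <-]; rewrite setTI; apply: borel_open.
by apply: open_comp => [z _|]; [exact: cf|exact: interval_open].
Qed.

Implicit Types mu : probability (borelType Xi) R.

(** A point outside the support has a null open neighbourhood, so it is null,
    and up to a null set the complement of the support consists of countably
    many such points. Discreteness thus replaces the usual appeal to a countable base of
    the topology. *)
Lemma measure_supp_setC mu : discrete_probability mu -> finite_set (supp mu) ->
  mu (~` supp mu) = 0%E.
Proof.
move=> [D [cD mD muD]] fS.
have mS : measurable (~` supp mu : set (borelType Xi)).
  by apply: measurableC; exact: (borel_finite _ fS).
apply: measure_negligible => //.
apply: (@negligibleS _ _ _ _ ((~` D) `|` (D `&` ~` supp mu))).
  by move=> x Sx; have [Dx|Dx] := pselect (D x); [right|left].
apply: negligibleU.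
  apply/negligibleP; first exact: measurableC.
  by rewrite [LHS](probability_setC mu mD) muD subee.
apply: (@negligible_countable _ _ _ mu).
  by apply: (sub_countable _ cD); apply: subset_card_le; exact: subIsetl.
move=> x [_ /existsNP[U /not_implyP[oU /not_implyP[Ux muU]]]].
exists U; split; [exact: borel_open| |by move=> _ ->].
apply/eqP; rewrite eq_le measure_ge0 andbT leNgt.
exact/negP.
Qed.

(** Removing the other points of the finite support leaves an open
    neighbourhood of [x], which meets the support at [x] only. *)
Lemma measure_supp_set1_gt0 mu x : mu (~` supp mu) = 0%E ->
  finite_set (supp mu) -> supp mu x -> (0 < mu [set x])%E.
Proof.
move=> mu0 fS Sx.
pose U := ~` (supp mu `\ x).
have fSx : finite_set (supp mu `\ x) by exact: finite_setD.
have oU : open U by rewrite openC; exact: closed_finite_metric.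
have muU : (0 < mu U)%E by apply: Sx => //; case=> _; exact.
apply: (lt_le_trans muU).
have mx : measurable ([set x] : set (borelType Xi)) by exact: borel_finite.
have mS : measurable (~` supp mu : set (borelType Xi)).
  by apply: measurableC; exact: (borel_finite _ fS).
apply: (@le_trans _ _ (mu ([set x] `|` ~` supp mu))).
  apply: le_measure; rewrite ?inE//; first exact: borel_open.
    exact: measurableU.
  move=> y /= Uy; have [->|yx] := eqVneq y x; [by left|right=> Sy].
  by apply: Uy; split => //; apply/eqP.
by rewrite -[leRHS]adde0 -mu0; exact: measureU2.
Qed.

End borel_metric.

Lemma finite_set_enum (T : eqType) (A : set T) : finite_set A ->
  exists (n : nat) (a : 'I_n -> T), injective a /\ range a = A.
Proof.
move=> /finite_seqP[t ->].
exists (size (undup t)), (tnth (in_tuple (undup t))); split.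
  by apply/tuple_uniqP; exact: undup_uniq.
apply/seteqP; split => [x [i _ <-]|x /= xt].
  by rewrite /= -mem_undup; exact: (mem_tnth i (in_tuple (undup t))).
have /tnthP[i xi] : x \in in_tuple (undup t) by rewrite mem_undup.
by exists i.
Qed.

(** The reweighted measure keeps the atoms of [mu] and multiplies their masses
    by the values of [f], up to normalization. *)
Lemma hatP_mixture (R : realType) (Xi : pmetricType R)
    (mu : probability (borelType Xi) R) (n : nat) (a : 'I_n -> Xi)
    (f : Xi -> R) (A : set (borelType Xi)) :
  injective a -> mu (~` range a) = 0%E -> continuous f ->
  0 < \sum_j fine (mu [set a j]) * f (a j) -> measurable A ->
  hatP mu f A = (\sum_i (fine (mu [set a i]) * f (a i) /
    (\sum_j fine (mu [set a j]) * f (a j)))%:E * \d_(a i : borelType Xi) A)%E.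
Proof.
move=> a_inj mua cf Z_gt0 mA.
have intE D : measurable D -> (\int[mu]_(x in D) (f x)%:E =
    (\sum_i fine (mu [set a i]) * (f (a i) * \1_D (a i)))%:E)%E.
  move=> mD; apply: integral_finite_support => //; last exact: borel_continuous.
  by move=> i; exact: borel_finite.
rewrite /hatP !intE//.
under [X in (_ / (X%:E))%E]eq_bigr do rewrite indicT mulr1.
rewrite inver gt_eqF// -EFinM mulr_suml -sumEFin; apply: eq_bigr => i _.
by rewrite diracE indicE -EFinM mulrA mulrAC.
Qed.

(** * Emerging dominance *)

Theorem theorem1 (R : realType) (Xi : pmetricType R)
  (compact_Xi : compact [set: Xi])
  (mu : probability (borelType Xi) R)
  (V : choiceType) (X : nat -> {fset V}) (x0 : V) (T : nat -> {fset V})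
  (Q : forall N : nat, Xi -> X N -> X N -> R)
  (X_incr : forall N, (0 < N)%N -> (X N `<=` X N.+1)%fset)
  (x0_X1 : x0 \in X 1%N)
  (T_sub : forall N, (0 < N)%N -> (T N `<=` X N)%fset)
  (x0_notin_T : forall N, (0 < N)%N -> x0 \notin T N)
  (Q_stochastic : forall N theta, (0 < N)%N -> stochastic (Q N theta))
  (Q_irreducible : forall N theta, (0 < N)%N -> irreducible_matrix (Q N theta))
  (m : nat -> Xi -> R)
  (m_def : forall N theta, (0 < N)%N ->
     expected_hitting_time x0 (T N) (Q N theta) (m N theta))
  (m_continuous : forall N, (0 < N)%N -> continuous (m N))
  (mu_discrete : discrete_probability mu)
  (mu_finite_supp : finite_set (supp mu))
  (K : nat) (thetas : 'I_K -> Xi)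
  (thetas_inj : injective thetas)
  (thetas_proper : range thetas `<` supp mu)
  (d : 'I_K -> 'I_K -> R)
  (H1 : exists i : 'I_K, forall theta, (supp mu `\` range thetas) theta ->
     m N theta / m N (thetas i) @[N --> \oo] --> (0 : R))
  (H2 : forall i j : 'I_K, i != j ->
     m N (thetas j) / m N (thetas i) @[N --> \oo] --> d i j /\ 0 < d i j) :
  emerging_dominance mu m thetas
    (fun i => 1 / (1 + \sum_(j < K | j != i)
       fine (mu [set thetas j]) / fine (mu [set thetas i]) * d i j)).
Proof.
have [i0 _] := H1.
have m_gt0 N theta : 0 < m N.+1 theta.
  apply: (lt_le_trans ltr01).
  exact: expected_hitting_time_ge1 (x0_notin_T _ _) (m_def N.+1 theta _).
have mu_out := measure_supp_setC mu mu_discrete mu_finite_supp.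
have [n [a [a_inj a_range]]] := finite_set_enum _ _ mu_finite_supp.
have supp_a i : supp mu (a i) by rewrite -a_range; exists i.
have ma i : measurable ([set a i] : set (borelType Xi)) by exact: borel_finite.
pose p i : R := fine (mu [set a i]).
have p_gt0 i : 0 < p i.
  rewrite fine_gt0// measure_supp_set1_gt0//=.
  by rewrite ltey_eq fin_num_measure.
(* Position of theta_k among the atoms. *)
have /choice[s sE] : forall k, exists i, a i = thetas k.
  move=> k; have : supp mu (thetas k) by apply: thetas_proper.1; exists k.
  by rewrite -a_range => -[i _ <-]; exists i.
have s_inj : injective s.
  by move=> k l skl; apply: thetas_inj; rewrite -!sE skl.
(* The time index is shifted by one: m_0 is unconstrained, and may vanish. *)
pose u N i := m N.+1 (a i).
have u_gt0 N i : 0 < u N i by exact: m_gt0.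
have out_cvg0 : exists k0, forall i, (forall k, s k != i) ->
    u N i / u N (s k0) @[N --> \oo] --> (0 : R).
  have [k0 Hk0] := H1; exists k0 => i si.
  rewrite /u sE; rewrite (cvg_shiftS (fun N => m N (a i) / m N (thetas k0))).
  apply: Hk0; split=> // -[k _ ski].
  by move: (si k); rewrite -(inj_eq a_inj) sE ski eqxx.
have ratio_cvg k j : k != j ->
    u N (s j) / u N (s k) @[N --> \oo] --> d k j /\ 0 < d k j.
  move=> kj; have [dkj ?] := H2 _ _ kj; split=> //.
  by rewrite /u !sE (cvg_shiftS (fun N => m N (thetas j) / m N (thetas k))).
pose w := limit_weight p s d.
have -> : (fun i => 1 / (1 + \sum_(j < K | j != i)
    fine (mu [set thetas j]) / fine (mu [set thetas i]) * d i j)) = w.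
  by apply/funext => i; rewrite /w /limit_weight /p sE;
     under [in RHS]eq_bigr do rewrite sE.
have w_gt0 k : 0 < w k by exact: (limit_weight_gt0 p u).
have w_sum : \sum_k w k = 1 by exact: (sum_limit_weight p u).
pose Z N := \sum_j p j * u N j.
have Z_gt0 N : 0 < Z N.
  rewrite /Z (bigD1 (s i0))//= ltr_pwDl ?mulr_gt0//.
  by rewrite sumr_ge0// => i _; rewrite mulr_ge0 ?ltW.
pose v N i := p i * u N i / Z N.
have v_ge0 N i : 0 <= v N i by rewrite divr_ge0 ?mulr_ge0 ?ltW.
have v_sum N : \sum_i v N i = 1.
  by rewrite /v -mulr_suml -/(Z N) divff ?gt_eqF.
have /choice[P PE] : forall N, exists P : probability (borelType Xi) R,
    forall A, P A = (\sum_i (v N i)%:E * \d_(a i : borelType Xi) A)%E.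
  by move=> N; exact: exists_mixture.
have [Q' QE] := exists_mixture _ (borelType Xi) _ _ thetas w
  (fun k => ltW (w_gt0 k)) w_sum.
(* Time N carries the weights v (N - 1), by the shift in u. *)
split=> //; exists (fun N => P N.-1), Q'; split => [[//|N] A _ mA|A _|f cf _].
- rewrite (hatP_mixture _ _ _ _ a)//=; first exact: PE.
  + by rewrite -a_range in mu_out.
  + exact: m_continuous.
  + exact: Z_gt0.
- exact: QE.
have mf := borel_continuous f cf.
rewrite (integral_mixture _ (borelType Xi) _ _ thetas w)//; last first.
  by move=> i; exact: borel_finite.
rewrite -(cvg_shiftS (fun N => \int[P N.-1]_x (f x)%:E)%E) /=.
under eq_cvg => N do rewrite (integral_mixture _ (borelType Xi) _ _ a (v N))//.
apply: cvg_EFin; first exact: nearW.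
rewrite /=.
have -> : \sum_k w k * f (thetas k) = \sum_i push_weights s w i * f (a i).
  by rewrite sum_push_weights; apply: eq_bigr => k _; rewrite sE.
apply: cvg_sum_ord => i; apply: cvgMr_tmp.
exact: normalized_weight_cvg.
Qed.
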